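(* There is a universal constant $c>0$ such that the following holds for every $0<\delta<c$. Let $X$ be a GNPC space, $B$ a tiny ball in $X$, $k\ge1$, and let $p_0,p_1,\dots,p_{k-1}\in B$ be an extended $(k-1,\delta)$-strainer at $p_k\in B$. Then for every $x\in B\setminus\{p_k\}$ sufficiently close to $p_k$ (i.e. $|xp_k|<\rho$ for some $\rho>0$ depending on $p_0,\dots,p_k$ and $\delta$) that satisfies $$|p_ip_k|=|p_ix|\quad\text{for all }0\le i\le k-1,$$ the sequence $p_0,p_1,\dots,p_k$ is an extended $(k,\delta)$-strainer at $x$.
   Context: A shortest path is an isometric embedding of a closed interval into a metric space. A complete geodesic space $(Y,d)$ is BNPC if for any two constant-speed reparametrized shortest paths $\gamma,\eta:[0,1]\to Y$, the function $t\mapsto d(\gamma(t),\eta(t))$ is convex on $[0,1]$. A metric space is locally BNPC if every point has a neighborhood that is BNPC with respect to the ambient metric. A geodesic is a curve whose restriction to each sufficiently small subinterval is a shortest path; a space is locally geodesically complete if every geodesic $\gamma:[a,b]\to X$ extends to a geodesic on $[a-\varepsilon,b+\varepsilon]$ for some $\varepsilon>0$. A GNPC space is a separable, locally compact, locally geodesically complete, locally BNPC metric space. A tiny ball in a GNPC space is an open metric ball $B$ of some radius $r$ such that the concentric closed ball of radius $10r$ is a compact BNPC space; shortest paths between points of $B$ are unique. Write $|ab|=d(a,b)$. Let $B$ be a tiny ball, $p\in B$, $q\in B\setminus\{p\}$, $x\in B\setminus\{q\}$, and let $x(t)$ be the unit-speed shortest path from $q$ to $x$. The angle viewed from $p$ at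 $q$ toward $x$ is $\angle pqx:=\lim_{t\to0}\tilde\angle pqx(t)$, where $\tilde\angle pqx(t)$ is the angle, at the vertex corresponding to $q$, of the Euclidean triangle with side lengths $|pq|$, $|px(t)|$, $|qx(t)|$ (the limit exists and $\cos\angle pqx=-\frac{d}{dt}\big|_{t=0^+}d(p,x(t))$). A point $p\in B$ is a $(1,\delta)$-strainer at $x\in B$ if there are $\bar p\in B$ (an opposite strainer for $p$ at $x$) and a neighborhood $U\subset B$ of $x$ with $p,\bar p\notin U$ such that $\angle py\bar p>\pi-\delta$ for all $y\in U$. Inductively, for $k\ge2$, $p_1,\dots,p_k\in B$ is a $(k,\delta)$-strainer at $x\in B$ if (1) $p_1,\dots,p_{k-1}$ is a $(k-1,\delta)$-strainer at $x$; (2) $p_k$ is a $(1,\delta)$-strainer at $x$; (3) there are an opposite strainer $\bar p_k$ for $p_k$ at $x$ and a neighborhood $U\subset B$ of $x$, not containing $p_1,\dots,p_k,\bar p_k$, such that $|\angle p_iyp_k-\pi/2|<\delta$ and $|\angle p_iy\bar p_k-\pi/2|<\delta$ for all $y\in U$ and $1\le i\le k-1$. For $k\ge1$, points $p_0,p_1,\dots,p_k\in B$ form an extended $(k,\delta)$-strainer at $x\in B$ (with base point $p_0$) if (1) $p_1,\dots,p_k$ is a $(k,\delta)$-strainer at $x$, with opposite strainers $\bar p_1,\dots,\bar p_k$, and (2) there is a neighborhood $U\subset B$ of $x$ such that $|\angle p_0yp_i-\pi/2|<\delta$ and $|\angle p_0y\bar p_i-\pi/2|<\delta$ for all $y\in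 U$ and $1\le i\le k$. By convention, any point $p_0\in B$ is an extended $(0,\delta)$-strainer at every $x\in B\setminus\{p_0\}$. *)

(* Defs.v *)
From HB Require Import structures.
From mathcomp Require Import all_boot all_order all_algebra.
From mathcomp Require Import all_classical all_reals all_analysis.

Set Implicit Arguments.
Unset Strict Implicit.
Unset Printing Implicit Defensive.

Import Order.TTheory GRing.Theory Num.Theory.
Import numFieldNormedType.Exports.

Local Open Scope classical_set_scope.
Local Open Scope ring_scope.

(** Curves are functions [R -> X] of which only the values on the stated
    interval are constrained. Subsets of [X] carry the ambient metric. *)

Section Paths.
Context {R : realType} {X : metricType R}.
Implicit Types (g : R -> X) (A : set X) (x y : X).

Definition shortest_path (a b : R) g : Prop :=
  forall s t, s \in `[a, b] -> t \in `[a, b] ->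
    mdist (g s) (g t) = `|s - t|.

Definition shortest_path_between x y g : Prop :=
  [/\ g 0 = x, g (mdist x y) = y & shortest_path 0 (mdist x y) g].

Definition constant_speed_shortest_path g : Prop :=
  forall s t, s \in `[0, 1] -> t \in `[0, 1] ->
    mdist (g s) (g t) = mdist (g 0) (g 1) * `|s - t|.

Definition geodesic (a b : R) g : Prop :=
  exists2 e : R, 0 < e &
    forall s t, a <= s -> s <= t -> t <= b -> t - s <= e ->
      shortest_path s t g.

Definition complete_subspace A : Prop :=
  forall F : set_system X, ProperFilter F -> cauchy F -> F A ->
    exists2 x, A x & F --> x.

Definition geodesic_subspace A : Prop :=
  forall x y, A x -> A y ->
    exists2 g, shortest_path_between x y g &
      forall t, t \in `[0, mdist x y] -> A (g t).

Definition BNPC A : Prop :=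
  [/\ complete_subspace A,
      geodesic_subspace A &
      forall g h : R -> X,
        (forall t, t \in `[0, 1] -> A (g t) /\ A (h t)) ->
        constant_speed_shortest_path g -> constant_speed_shortest_path h ->
        @convex_function R R^o `[0, 1]%classic
          (fun t : R => mdist (g t) (h t))].

End Paths.

Definition locally_geodesically_complete (R : realType) (X : metricType R) :
    Prop :=
  forall (a b : R) (g : R -> X), a < b -> geodesic a b g ->
    exists2 e : R, 0 < e &
      exists2 h : R -> X, geodesic (a - e) (b + e) h &
        forall t, t \in `[a, b] -> h t = g t.

Definition locally_BNPC (R : realType) (X : metricType R) : Prop :=
  forall x : X, exists2 A : set X, nbhs x A & BNPC A.

Definition separable (T : topologicalType) : Prop :=
  exists2 D : set T, countable D & dense D.

Definition GNPC (R : realType) (X : metricType R) : Prop :=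
  [/\ separable X, locally_compact [set: X],
      locally_geodesically_complete X & locally_BNPC X].

Section Strainers.
Context {R : realType} {X : metricType R}.
Implicit Types (B : set X) (x y z : X) (p pbar : nat -> X) (delta : R).

(** The library's [closed_ball] is the closure of the open ball, which may be
    smaller than the closed metric ball. *)
Definition tiny_ball B : Prop :=
  exists (o : X) (r : R),
    let C := [set y | mdist o y <= 10 * r] in
    [/\ 0 < r, B = ball o r, compact C & BNPC C].

(** Angle between the sides of lengths [a] and [b] of a Euclidean triangle
    whose third side has length [c], by the law of cosines. *)
Definition euclidean_angle (a b c : R) : R :=
  acos ((a ^+ 2 + b ^+ 2 - c ^+ 2) / (2 * a * b)).

(** A chosen unit-speed shortest path from [y] to [x]; between points of a
    tiny ball it is unique on [[0, mdist y x]]. *)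
Definition path_to y x : R -> X :=
  xget (fun=> y) [set g | shortest_path_between y x g].

Definition comparison_angle z y x (t : R) : R :=
  euclidean_angle (mdist z y) (mdist y (path_to y x t))
                  (mdist z (path_to y x t)).

(** The angle viewed from [z] at [y] toward [x], not symmetric in [z] and [x];
    meaningful only for [z] and [x] distinct from [y]. *)
Definition angle z y x : R := lim (comparison_angle z y x t @[t --> 0^'+]).

Definition opposite_strainer B delta z zbar x : Prop :=
  [/\ B z, B zbar &
      exists U : set X,
        [/\ nbhs x U, U `<=` B, ~ U z, ~ U zbar &
            forall y, U y -> pi - delta < angle z y zbar]].

Definition almost_right delta (a : R) : Prop := `|a - pi / 2| < delta.

(** [p 1, ..., p k] is a (k, delta)-strainer at [x] with opposite strainers
    [pbar 1, ..., pbar k]. The value at [k = 0] is a mere convention and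
    [p 0], [pbar 0] are not used. *)
Fixpoint strainer B delta (k : nat) p pbar x : Prop :=
  match k with
  | 0 => True
  | 1 => opposite_strainer B delta (p 1%N) (pbar 1%N) x
  | k'.+1 =>
    [/\ strainer B delta k' p pbar x,
        opposite_strainer B delta (p k) (pbar k) x &
        exists U : set X,
          [/\ nbhs x U, U `<=` B,
              forall i, (1 <= i <= k)%N -> ~ U (p i),
              ~ U (pbar k) &
              forall y i, U y -> (1 <= i <= k')%N ->
                almost_right delta (angle (p i) y (p k)) /\
                almost_right delta (angle (p i) y (pbar k))]]
  end.

(** [p 0, ..., p k] is an extended (k, delta)-strainer at [x] with base point
    [p 0]. The points avoided by [U] are those for which the angles would
    otherwise be undefined. *)
Definition extended_strainer B delta (k : nat) p x : Prop :=
  if k == 0%N then [/\ B (p 0%N), B x & x <> p 0%N]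
  else B (p 0%N) /\
    exists2 pbar : nat -> X, strainer B delta k p pbar x &
      exists U : set X,
        [/\ nbhs x U, U `<=` B, ~ U (p 0%N),
            forall i, (1 <= i <= k)%N -> ~ U (p i) /\ ~ U (pbar i) &
            forall y i, U y -> (1 <= i <= k)%N ->
              almost_right delta (angle (p 0%N) y (p i)) /\
              almost_right delta (angle (p 0%N) y (pbar i))].

End Strainers.

(* Main.v *)
Require Import Defs.
From mathcomp Require Import all_boot all_order all_algebra.
From mathcomp Require Import all_classical all_reals all_analysis.
From mathcomp Require Import ring lra.

Set Implicit Arguments.
Unset Strict Implicit.
Unset Printing Implicit Defensive.

Import Order.TTheory GRing.Theory Num.Theory.
Import numFieldNormedType.Exports.

Local Open Scope classical_set_scope.
Local Open Scope ring_scope.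

(** The argument is a first-variation argument at the single scale
    [r = mdist (p k) x], and every angle in it is controlled through its cosine:
    [angle z y x] equals [acos (- D)], where [D] is the right derivative at [0]
    of the distance from [z] along the shortest path from [y] to [x]
    ([slope_cvg], [angle_acos]). This distance is convex, so its difference
    quotients decrease to [D] as the step shrinks; each of them is an upper
    bound for [D].

    Write [p] for [p k]. Two families of quotients along the geodesic rays from
    [p] matter: the spread [mdist (g t) (h t) / t] of two rays, and the slope
    of [mdist z] along one ray for the fixed points [z = p i]. Both are monotone
    in [t] and Lipschitz in the endpoints of the rays on a compact sphere, hence
    converge uniformly as [t] tends to [0], as in Dini's theorem
    ([monotone_equicontinuous_uniform]). Below some scale [rho], they change by
    at most a prescribed [e]. Take [x] with [2 r <= rho].

    Extend the shortest path from [p] to [x] beyond [x] to a point [q] at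
    distance [2 r] from [p] ([shortest_path_extension]); [q] is the strainer
    opposite to [p]. Geodesics may branch, so for [y] near [x] an extension [g]
    of the path from [p] to [y] need not end at [q]. But it passes close to [x]
    at time [r], so uniformity makes its spread from the ray to [q] at time
    [2 r] small relative to [r]: the path from [y] to [q] leaves [y] in nearly
    the direction opposite to [p] ([opposite_direction]). Three estimates follow
    ([opposite_strainer_near]).
    - The distance from [p] grows along [g] with speed [1], so its slope towards
      [q] is nearly [1], and [angle p y q] is nearly [pi].
    - If [mdist z p = mdist z x], the slope of [mdist z] at [y] towards [p] is
      almost nonpositive, since the difference quotient over the whole path
      compares [mdist z p] with [mdist z y]. The slope towards [q] is almost
      nonpositive as well: along the ray from [p] through [x] the quotient at
      time [r] vanishes, so by uniformity the one at time [2 r] is small.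
    - These two slopes have an almost nonnegative sum, by convexity of [mdist z]
      along [g] at [y]. Hence both are nearly [0], and [angle z y p] and
      [angle z y q] are nearly [pi / 2].

    Strainer conditions among the earlier points are open, so they pass from
    [p k] to all nearby [x]. *)

(** * The arc cosine up to the endpoints of its domain *)

Section Acos.
Context {R : realType}.

Lemma acos_continuous_itv : {within `[(-1 : R), 1], continuous (@acos R)}.
Proof.
have acosI (x : R) : x \in `[-1, 1] -> acos x \in `[0, pi].
  by rewrite !in_itv/= => xI; rewrite acos_ge0// acos_lepi.
have := @segment_dec_surj_continuous R (-1) 1 (@acos R).
rewrite acosN1 acos1; apply.
  move=> x y xI yI; rewrite -[in RHS](acosK xI) -[in RHS](acosK yI).
  by rewrite !leNgt ltr_cos// acosI.
move=> y /= yI; exists (cos y); last exact: cosK.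
by rewrite /= in_itv/= cos_geN1 cos_le1.
Qed.

(** Comparison angles may converge to [0] or [pi], where [acos] is continuous
    only relative to its domain. *)
Lemma cvg_acos (T : Type) (F : set_system T) (u : T -> R) (l : R) :
  Filter F -> -1 <= l <= 1 -> (\forall t \near F, -1 <= u t <= 1) ->
  u @ F --> l -> acos (u t) @[t --> F] --> acos l.
Proof.
move=> FF lI uI ul.
have /subspace_continuousP/(_ l) := acos_continuous_itv.
rewrite /= in_itv/= => /(_ lI) al.
apply: cvg_trans al => A /= [e e0 eA].
have : \forall t \near F, `|l - u t| < e by move/cvgrPdist_lt : ul => /(_ _ e0).
apply: filterS2 uI => t uI ue; exact: (eA (u t)).
Qed.

(** The margin [e] on the cosine that secures the two angle conditions of a
    (k, delta)-strainer. *)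
Definition acos_sharp (delta e : R) := forall c : R, -1 <= c <= 1 ->
  (c <= -1 + e -> pi - delta < acos c) /\
  (`|c| <= e -> almost_right delta (acos c)).

Lemma acos_sharp_exists (delta : R) : 0 < delta ->
  exists2 e : R, 0 < e & acos_sharp delta e.
Proof.
move=> d0.
have /subspace_continuousP ac := acos_continuous_itv.
have I1 : (-1 : R) \in `[-1, 1] by rewrite in_itv/=; lra.
have I0 : (0 : R) \in `[-1, 1] by rewrite in_itv/=; lra.
have /cvgrPdist_lt/(_ _ d0) [e1 /= e10 h1] := ac _ I1.
have /cvgrPdist_lt/(_ _ d0) [e2 /= e20 h2] := ac _ I0.
exists (Num.min e1 e2 / 2); first by rewrite divr_gt0// lt_min e10.
have m0 : 0 < Num.min e1 e2 by rewrite lt_min e10.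
have m1 : Num.min e1 e2 <= e1 by rewrite ge_min lexx.
have m2 : Num.min e1 e2 <= e2 by rewrite ge_min lexx orbT.
move=> c cI; split => hc.
  have /(_ c) := h1; rewrite /ball_/= in_itv/= => /(_ _ cI).
  rewrite /from_subspace acosN1 => H.
  have /H : `|-1 - c| < e1 by rewrite ltr_norml; lra.
  by rewrite ltr_norml; lra.
have /(_ c) := h2; rewrite /ball_/= in_itv/= => /(_ _ cI).
rewrite /from_subspace acos0 /almost_right (distrC (acos c)); apply.
by rewrite sub0r normrN; lra.
Qed.

End Acos.

(** * Shortest paths in a nonpositively curved set *)

Section Segments.
Context {R : realType} {X : metricType R}.
Implicit Types (a b s t L : R) (g h : R -> X) (A C : set X) (x y z : X).

Lemma ratio_itv01 s t : 0 <= s -> s <= t -> 0 < t -> 0 <= s / t <= 1.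
Proof.
by move=> s0 st t0; rewrite (divr_ge0 s0 (ltW t0))/= ler_pdivrMr// mul1r.
Qed.

(** Staying in [C] is part of the notion because convexity of the distance is
    known for paths inside [C] only. *)
Definition segment_in C L g :=
  [/\ 0 <= L, shortest_path 0 L g & forall t, 0 <= t <= L -> C (g t)].

Lemma shortest_pathP a b g : shortest_path a b g <->
  forall s t, a <= s -> s <= t -> t <= b -> mdist (g s) (g t) = t - s.
Proof.
split=> [gP s t sa st tb|gP s t].
  rewrite gP ?in_itv/=; first by rewrite ler0_norm; lra.
  - by rewrite sa; lra.
  - by rewrite tb; lra.
rewrite !in_itv/= => /andP[sa sb] /andP[ta tb].
have [st|/ltW ts] := lerP s t; first by rewrite gP// ler0_norm; lra.
by rewrite metric_sym gP// ger0_norm; lra.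
Qed.

Lemma shortest_path_between_length L g : 0 <= L -> shortest_path 0 L g ->
  mdist (g 0) (g L) = L.
Proof. by move=> L0 /shortest_pathP ->//; rewrite subr0. Qed.

Lemma segment_in_cst C z : C z -> segment_in C 0 (fun=> z).
Proof.
move=> Cz; split => //; apply/shortest_pathP => s t s0 st t0.
by rewrite mdistxx; lra.
Qed.

Lemma segment_in_sub C a b L g : 0 <= a -> a <= b -> b <= L ->
  segment_in C L g -> segment_in C (b - a) (fun t => g (a + t)).
Proof.
move=> a0 ab bL [L0 /shortest_pathP gP gC]; split; first lra.
  by apply/shortest_pathP => s t s0 st tb; rewrite gP; lra.
by move=> t tI; apply: gC; lra.
Qed.

Lemma segment_in_prefix C a L g : 0 <= a -> a <= L ->
  segment_in C L g -> segment_in C a g.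
Proof.
move=> a0 aL /(segment_in_sub (lexx _) a0 aL).
by rewrite subr0; congr segment_in; apply/funext => t; rewrite add0r.
Qed.

Lemma segment_in_rev C a L g : 0 <= a -> a <= L ->
  segment_in C L g -> segment_in C a (fun t => g (a - t)).
Proof.
move=> a0 aL [L0 /shortest_pathP gP gC]; split => //.
  by apply/shortest_pathP => s t s0 st ta; rewrite metric_sym gP; lra.
by move=> t tI; apply: gC; lra.
Qed.

Lemma concat_shortest_path L1 L2 g h : 0 <= L1 -> 0 <= L2 ->
  shortest_path 0 L1 g -> shortest_path 0 L2 h -> g L1 = h 0 ->
  mdist (g 0) (h L2) = L1 + L2 ->
  shortest_path 0 (L1 + L2) (fun t => if t <= L1 then g t else h (t - L1)).
Proof.
move=> L10 L20 /shortest_pathP gP /shortest_pathP hP gh d.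
apply/shortest_pathP => s t s0 st tL.
have [tL1|tL1] := lerP t L1.
  by rewrite (le_trans st tL1) gP.
have [sL1|sL1] := lerP s L1; last by rewrite hP; lra.
apply/eqP; rewrite eq_le; apply/andP; split.
  have := metric_triangle (g s) (g L1) (h (t - L1)).
  by rewrite {2}gh gP// hP; lra.
have := metric_triangle (g 0) (g s) (h L2).
have := metric_triangle (g s) (h (t - L1)) (h L2).
by rewrite d (gP 0 s)// (hP _ L2); lra.
Qed.

Section BNPC.
Variables (C : set X).
Hypothesis bnpc : BNPC C.

(** The convexity axiom, restated for unit-speed paths of possibly different
    lengths [a] and [b], which are run through in proportional time. *)
Lemma BNPC_convex a b g h (u : R) : segment_in C a g -> segment_in C b h ->
  0 <= u <= 1 ->
  mdist (g (u * a)) (h (u * b)) <=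
    (1 - u) * mdist (g 0) (h 0) + u * mdist (g a) (h b).
Proof.
move=> [a0 gP gC] [b0 hP hC] /andP[u0 u1].
have cs (c : R) (f : R -> X) : 0 <= c -> shortest_path 0 c f ->
    constant_speed_shortest_path (fun t => f (t * c)).
  move=> c0 fP s t; rewrite !in_itv/= => /andP[s0 s1] /andP[t0 t1].
  rewrite /= mul0r mul1r (shortest_path_between_length c0 fP) fP; last 2 first.
  - by rewrite in_itv/= mulr_ge0//= ler_piMl.
  - by rewrite in_itv/= mulr_ge0//= ler_piMl.
  by rewrite -mulrBl normrM (ger0_norm c0) mulrC.
have [_ _ conv] := bnpc.
have {}conv := conv _ _ _ (cs _ _ a0 gP) (cs _ _ b0 hP).
have ghC t : t \in `[0, 1] -> C (g (t * a)) /\ C (h (t * b)).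
  rewrite in_itv/= => /andP[t0 t1].
  by split; [apply: gC|apply: hC]; rewrite mulr_ge0//= ler_piMl.
have := conv ghC (Itv01 u0 u1) 1 0.
rewrite !inE/= !in_itv/= !lexx !ler01 => /(_ isT isT).
have uE : convex.conv (Itv01 u0 u1) (1 : convex_lmodType R^o) 0 = u.
  by apply: etrans (convRE (1 : R) 0 _) _; rewrite /= mulr1 mulr0 addr0.
by rewrite uE convRE/= !mul1r !mul0r addrC.
Qed.

Lemma cone_monotone L g h s t : segment_in C L g -> segment_in C L h ->
  g 0 = h 0 -> 0 <= s -> s <= t -> t <= L ->
  t * mdist (g s) (h s) <= s * mdist (g t) (h t).
Proof.
move=> gS hS gh s0 st tL.
have [t0|t0] := eqVneq t 0.
  by have -> : s = 0; [lra|rewrite gh mdistxx t0 !mul0r].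
have {}t0 : 0 < t by rewrite lt_neqAle eq_sym t0 (le_trans s0).
have sub f := @segment_in_prefix C t L f (ltW t0) tL.
have uI : 0 <= s / t <= 1 by apply: ratio_itv01; rewrite // ltW.
have := BNPC_convex (sub _ gS) (sub _ hS) uI.
rewrite gh mdistxx mulr0 add0r divfK ?gt_eqF// => H.
by rewrite -ler_pdivlMl// mulrA [_^-1 * s]mulrC.
Qed.

Lemma segment_unique L g h : segment_in C L g -> segment_in C L h ->
  g 0 = h 0 -> g L = h L -> forall t, 0 <= t <= L -> g t = h t.
Proof.
move=> gS hS g0 gL t /andP[t0 tL]; apply: mdist_positivity.
have := cone_monotone gS hS g0 t0 tL (lexx _).
rewrite gL mdistxx mulr0.
have [L0|L0] := eqVneq L 0.
  have -> : t = 0 by move: tL; rewrite L0; lra.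
  by rewrite g0 mdistxx.
have ? : 0 < L by rewrite lt_neqAle eq_sym L0 (le_trans t0).
by rewrite pmulr_rle0// => H; apply/eqP; rewrite eq_le H mdist_ge0.
Qed.

(** At equal times rather than proportional ones. Half of the bound is
    convexity at the ratio [s / a]; the other half pays for the difference of
    the two lengths, which is at most [mdist (g a) (h b)]. *)
Lemma fan_bound a b g h s : segment_in C a g -> segment_in C b h ->
  g 0 = h 0 -> 0 < a -> 0 <= s -> s <= a -> s <= b ->
  mdist (g s) (h s) <= 2 * s * mdist (g a) (h b) / a.
Proof.
move=> gS hS gh a0 s0 sa sb.
have uI : 0 <= s / a <= 1 by exact: ratio_itv01.
have := BNPC_convex gS hS uI.
rewrite gh mdistxx mulr0 add0r divfK ?gt_eqF//.
set d := mdist (g a) (h b) => H.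
have [_ /shortest_pathP gP _] := gS; have [b0 hP _] := hS.
have dab : `|a - b| <= d.
  have := metric_triangle (g 0) (g a) (h b).
  have := metric_triangle (g 0) (h b) (g a).
  rewrite [mdist (h b) _]metric_sym -/d {2 3}gh.
  rewrite (shortest_path_between_length b0 hP) gP//; last exact: ltW.
  by rewrite ler_norml; lra.
have hd : mdist (h (s / a * b)) (h s) <= s / a * d.
  rewrite hP ?in_itv/=; last 2 first.
  - by case/andP: uI => u0 u1; rewrite mulr_ge0//= ler_piMl.
  - by rewrite s0.
  have -> : s / a * b - s = s / a * (b - a) by field; rewrite gt_eqF.
  case/andP: uI => u0 _.
  by rewrite normrM ger0_norm// ler_wpM2l// distrC.
have := metric_triangle (g s) (h (s / a * b)) (h s).
have -> : 2 * s * d / a = s / a * d + s / a * d by ring.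
by move=> /le_trans; apply; rewrite lerD.
Qed.

(** A point is a path of length zero, so convexity applies to the distance from
    a fixed point. *)
Lemma midpoint_convex z L h s t : C z -> segment_in C L h ->
  0 <= s -> 0 <= t -> 0 <= s - t -> s + t <= L ->
  2 * mdist z (h s) <= mdist z (h (s - t)) + mdist z (h (s + t)).
Proof.
move=> Cz hS s0 t0 st0 stL.
have st : s - t <= s + t by lra.
have := BNPC_convex (segment_in_cst Cz) (segment_in_sub st0 st stL hS).
move=> /(_ 2^-1); rewrite addr0.
have -> : s - t + 2^-1 * (s + t - (s - t)) = s by lra.
have -> : s - t + (s + t - (s - t)) = s + t by lra.
have uI : 0 <= (2^-1 : R) <= 1 by lra.
by move=> /(_ uI); lra.
Qed.

Lemma quotient_monotone z L h s t : C z -> segment_in C L h ->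
  0 < s -> s <= t -> t <= L ->
  (mdist z (h s) - mdist z (h 0)) / s <= (mdist z (h t) - mdist z (h 0)) / t.
Proof.
move=> Cz hS s0 st tL.
have t0 : 0 < t by lra.
have hS' := segment_in_prefix (ltW t0) tL hS.
have uI : 0 <= s / t <= 1 by apply: ratio_itv01; rewrite // ltW.
have := BNPC_convex (segment_in_cst Cz) hS' uI.
rewrite divfK ?gt_eqF// => H.
rewrite ler_pdivrMr//; apply: le_trans (lerB H (lexx _)) _.
have -> : forall u v : R, (u - v) / t * s = s / t * (u - v) by move=> *; ring.
by lra.
Qed.

End BNPC.

End Segments.

(** * Tiny balls, directional derivatives and angles *)

Section Angles.
Context {R : realType} {X : metricType R}.
Implicit Types (a b s t L : R) (g h : R -> X) (A C B : set X) (x y z : X).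

Lemma mdist_lipschitz z x y : `|mdist z x - mdist z y| <= mdist x y.
Proof.
have := metric_triangle z x y; have := metric_triangle z y x.
by rewrite (metric_sym y x) ler_norml; lra.
Qed.

Lemma mdist_continuous z : continuous (mdist z : X -> R).
Proof.
move=> x; apply/cvgrPdist_lt => e e0.
apply/metricType_numDomainType.nbhs_mdistP.
exists e => //= y; exact: le_lt_trans (mdist_lipschitz _ _ _).
Qed.

(** What is used of a tiny ball [B] and its concentric compact ball [C]. The
    last field holds for every shortest path between points of [B], so that the
    arbitrary choice made by [path_to] also stays in [C], where shortest paths
    are unique. *)
Record ambient C B : Prop := Ambient {
  ambient_bnpc : BNPC C;
  ambient_compact : compact C;
  ambient_open : forall x, B x ->
    exists2 e : R, 0 < e & forall y, mdist x y < e -> B y;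
  ambient_path : forall y x g, B y -> B x -> shortest_path_between y x g ->
    forall t, 0 <= t <= mdist y x -> C (g t) }.

Lemma tiny_ball_ambient B : tiny_ball B -> exists C, ambient C B.
Proof.
move=> [m [r [r0 -> cC bC]]]; exists [set y | mdist m y <= 10 * r].
split => //.
  move=> x; rewrite ballEmdist/= => mx.
  exists (r - mdist m x) => [|y xy]; first lra.
  by have := metric_triangle m x y; lra.
move=> y x g; rewrite !ballEmdist/= => oy ox [gy gx /shortest_pathP gP] t.
move=> /andP[t0 tL].
have := metric_triangle m y x; have := metric_triangle y m x.
have := metric_triangle m y (g t); have := metric_triangle m x (g t).
rewrite (metric_sym y m) -{2}gy -{2}gx (metric_sym (g (mdist y x))).
rewrite (gP 0 t)// (gP t)//.
by lra.
Qed.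

Section Ambient.
Variables (C B : set X).
Hypothesis amb : ambient C B.
Let bnpc := ambient_bnpc amb.

Lemma ambient_sub x : B x -> C x.
Proof.
move=> Bx; apply: (@ambient_path _ _ amb x x (fun=> x) Bx Bx _ 0).
  split => //; rewrite mdistxx; apply/shortest_pathP => s t s0 st t0.
  by rewrite mdistxx; lra.
by rewrite lexx mdist_ge0.
Qed.

Lemma between_segment y x g : B y -> B x -> shortest_path_between y x g ->
  segment_in C (mdist y x) g.
Proof.
move=> By Bx gP; split; [exact: mdist_ge0|by case: gP|].
exact: (ambient_path amb By Bx gP).
Qed.

Lemma path_toP y x : B y -> B x -> shortest_path_between y x (path_to y x).
Proof.
move=> By Bx; rewrite /path_to.
have [_ geo _] := bnpc.
have [g gP _] := geo _ _ (ambient_sub By) (ambient_sub Bx).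
exact: (xgetPex (fun=> y) (ex_intro _ g gP)).
Qed.

(** Makes it possible to compute with [path_to] along any convenient shortest
    path, for instance a piece of a longer one. *)
Lemma path_to_unique y x g : B y -> B x -> shortest_path_between y x g ->
  forall t, 0 <= t <= mdist y x -> path_to y x t = g t.
Proof.
move=> By Bx gP t tI.
have pP := path_toP By Bx.
apply: (segment_unique bnpc (between_segment By Bx pP)
  (between_segment By Bx gP)) => //.
  by case: pP gP => -> _ _ [-> _ _].
by case: pP gP => _ -> _ [_ -> _].
Qed.

Lemma path_to_dist y x t : B y -> B x -> 0 <= t -> t <= mdist y x ->
  mdist y (path_to y x t) = t.
Proof.
move=> By Bx t0 tL; have [p0 _ /shortest_pathP pd] := path_toP By Bx.
by rewrite -{1}p0 pd ?subr0.
Qed.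

Definition slope z y x t : R := (mdist z (path_to y x t) - mdist z y) / t.

Lemma slope_itv z y x t : B z -> B y -> B x -> 0 < t -> t <= mdist y x ->
  -1 <= slope z y x t <= 1.
Proof.
move=> Bz By Bx t0 tL.
rewrite /slope ler_pdivlMr// ler_pdivrMr// mulN1r mul1r.
have := mdist_lipschitz z (path_to y x t) y.
rewrite (metric_sym (path_to y x t)) path_to_dist//; last exact: ltW.
by rewrite ler_norml.
Qed.

(** Slopes are monotone in time and bounded by [1], so they have a limit at
    [0], which the slope over the whole path bounds from above. *)
Lemma slope_cvg z y x : B z -> B y -> B x -> x <> y ->
  exists2 D : R, slope z y x t @[t --> 0^'+] --> D &
    D <= (mdist z x - mdist z y) / mdist y x.
Proof.
move=> Bz By Bx xy.
have L0 : 0 < mdist y x by rewrite mdist_gt0; apply/eqP => /esym.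
have pP := path_toP By Bx; have pS := between_segment By Bx pP.
have [p0 pL /shortest_pathP pd] := pP.
have mono s t : 0 < s -> s <= t -> t <= mdist y x ->
    slope z y x s <= slope z y x t.
  move=> s0 st tL.
  have := quotient_monotone bnpc (ambient_sub Bz) pS s0 st tL.
  by rewrite p0.
have Dc := @nondecreasing_at_right_cvgr R (slope z y x) 0
  (BRight (mdist y x)).
have lb t : 0 < t <= mdist y x -> -1 <= slope z y x t.
  by case/andP=> t0 tL; case/andP: (slope_itv Bz By Bx t0 tL).
have hlb : has_lbound (slope z y x @` [set` `]0, (mdist y x)]]).
  by exists (-1) => _ [t /= + <-]; rewrite in_itv/=; exact: lb.
eexists.
  apply: Dc => //.
  move=> s t; rewrite !in_itv/= => /andP[s0 sL] /andP[t0 tL] st.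
  exact: mono.
apply: ge_inf => //.
exists (mdist y x); first by rewrite /= in_itv/= L0 lexx.
by rewrite /slope pL.
Qed.

Lemma near0_le L : 0 < L -> \forall t \near 0^'+, 0 < t /\ t <= L.
Proof.
move=> L0; near=> t; split; near: t; first exact: nbhs_right_gt.
exact: nbhs_right_le.
Unshelve. all: by end_near. Qed.

(** First variation formula. With [a = mdist z y] and slope [Q] at time [t], the
    law of cosines gives the comparison angle the cosine
    [t / (2 a) - Q - t Q ^ 2 / (2 a)], which tends to [- D]. *)
Lemma angle_acos z y x (D : R) : B z -> B y -> B x -> z <> y -> x <> y ->
  slope z y x t @[t --> 0^'+] --> D -> -1 <= D <= 1 /\ angle z y x = acos (- D).
Proof.
move=> Bz By Bx zy xy cD.
have L0 : 0 < mdist y x by rewrite mdist_gt0; apply/eqP => /esym.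
have a0 : 0 < mdist z y by rewrite mdist_gt0; apply/eqP.
have [p0 pL /shortest_pathP pd] := path_toP By Bx.
have DI : -1 <= D <= 1.
  apply/andP; split.
    apply: (cvgr_to_ge cD) => //.
    apply: filterS (near0_le L0) => t [t0 tL].
    by case/andP: (slope_itv Bz By Bx t0 tL).
  apply: (cvgr_to_le cD) => //.
  apply: filterS (near0_le L0) => t [t0 tL].
  by case/andP: (slope_itv Bz By Bx t0 tL).
split => //; rewrite /angle; apply: cvg_lim; first exact: Rhausdorff.
apply: cvg_acos.
- by move: DI; lra.
- apply: filterS (near0_le L0) => t [t0 tL].
  have yt : mdist y (path_to y x t) = t by rewrite path_to_dist// ltW.
  rewrite yt.
  set a := mdist z y; set c := mdist z _.
  have := metric_triangle z y (path_to y x t).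
  have := metric_triangle z (path_to y x t) y.
  have := metric_triangle y z (path_to y x t).
  rewrite (metric_sym (path_to y x t)) (metric_sym y z) yt -/a -/c => h1 h2 h3.
  have at0 : 0 < 2 * a * t by rewrite !mulr_gt0.
  have c0 : 0 <= c := mdist_ge0 _ _.
  by rewrite ler_pdivlMr// ler_pdivrMr//; apply/andP; split; nra.
pose F t := t / (2 * mdist z y) - slope z y x t
  - t * slope z y x t * slope z y x t / (2 * mdist z y).
have -> : - D = 0 / (2 * mdist z y) - D - 0 * D * D / (2 * mdist z y) by ring.
have cF : F t @[t --> 0^'+] -->
    0 / (2 * mdist z y) - D - 0 * D * D / (2 * mdist z y).
  have t0 : (t : R) @[t --> 0^'+] --> (0 : R) by exact: cvg_at_right_filter.
  apply: cvgB; first by apply: cvgB => //; exact: cvgMr_tmp.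
  by apply: cvgMr_tmp; apply: cvgM => //; apply: cvgM.
apply: cvg_trans cF; apply: near_eq_cvg.
apply: filterS (near0_le L0) => t [t0 tL].
have yt : mdist y (path_to y x t) = t by rewrite path_to_dist// ltW.
rewrite /F yt /slope; field.
by rewrite !gt_eqF.
Qed.

End Ambient.
End Angles.

(** * Uniform convergence at small scales *)

(** Dini's theorem for families decreasing as [t] tends to [0]: equicontinuity
    in the parameter stands in for continuity of the limit. The conclusion
    compares two times and thus avoids naming the limit. Around each parameter
    [a], a time at which [F] is within [e / 3] of its infimum works for all
    nearby parameters, and compactness of [K] finds a common time. *)
Lemma monotone_equicontinuous_uniform (R : realType) (T : topologicalType)
    (K : set T) (F : R -> T -> R) (r m : R) :
  compact K -> 0 < r ->
  (forall a (s t : R), K a -> 0 < s -> s <= t -> t <= r -> F s a <= F t a) ->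
  (forall a (t : R), K a -> 0 < t -> t <= r -> m <= F t a) ->
  (forall a (e : R), K a -> 0 < e -> \forall b \near a, K b ->
     forall t : R, 0 < t -> t <= r -> `|F t b - F t a| <= e) ->
  forall e : R, 0 < e -> \forall rho \near 0^'+, forall a, K a ->
    forall s t : R, 0 < s -> s <= t -> t <= rho -> F t a <= F s a + e.
Proof.
move=> cK r0 mono lb equi e e0.
have /near_covering_withinP := (compact_near_coveringP K).1 cK.
apply => a Ka.
pose E := [set F t a | t in `]0, r]].
have Ea t : 0 < t -> t <= r -> E (F t a).
  by move=> t0 tr; exists t => //=; rewrite in_itv/= t0.
have hE : has_inf E.
  split; first by exists (F r a); exact: Ea.
  by exists m => _ [t /= + <-]; rewrite in_itv/= => /andP[]; exact: lb.
have e30 : 0 < e / 3 by rewrite divr_gt0.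
have [_ [ta /= + <-] Fta] := inf_adherent e30 hE.
rewrite in_itv/= => /andP[ta0 tar].
exists ([set b | K b -> forall t, 0 < t -> t <= r -> `|F t b - F t a| <= e / 3],
        [set rho | 0 < rho /\ rho <= ta]) => /=.
  by split; [exact: equi|exact: near0_le].
move=> [b rho] /= [eb [rho0 rhota]] Kb s t s0 st trho.
have {}eb := eb Kb.
have sr : s <= r by lra.
have Fs := ge_inf hE.2 (Ea s s0 sr).
have := mono b t ta Kb (lt_le_trans s0 st) (le_trans trho rhota) tar.
have := eb ta ta0 tar; have := eb s s0 sr.
by rewrite !ler_norml => /andP[? ?] /andP[? ?]; lra.
Qed.

(** * Geodesic rays from a point *)

Section Rays.
Context {R : realType} {X : metricType R}.
Implicit Types (a b s t L : R) (g h : R -> X) (A C B : set X) (x y z p u v : X).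

Lemma compact_metric_sphere C p (r : R) : compact C ->
  compact (C `&` [set u | mdist p u = r]).
Proof.
move=> cC; apply: compact_closedI => //.
have -> : [set u | mdist p u = r] = mdist p @^-1` [set r] by [].
apply: closed_comp => [x _|]; first exact: mdist_continuous.
exact: accessible_closed_set1 (hausdorff_accessible (@Rhausdorff R)) _.
Qed.

Section Ambient.
Variables (C B : set X).
Hypothesis amb : ambient C B.
Let bnpc := ambient_bnpc amb.

(** A local extension of the path from [p] to [z] is a shortest path near [z],
    so [mdist p] is convex along it there. As it has slope [1] before [z], it
    has slope at least [1] after [z]; the triangle inequality gives the
    converse. *)
Lemma short_extension p z (R0 : R) : locally_geodesically_complete X ->
  (forall q, mdist p q <= R0 -> B q) -> z <> p -> mdist p z < R0 ->
  exists w, [/\ mdist p z < mdist p w, mdist p w <= R0 &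
                mdist p w = mdist p z + mdist z w].
Proof.
set L := mdist p z => lgc ball_B zp zR0.
have L0 : 0 < L by rewrite mdist_gt0; apply/eqP => /esym.
have Bp : B p by apply: ball_B; rewrite mdistxx; lra.
have Bz : B z by apply: ball_B; exact: ltW.
have := path_toP amb Bp Bz.
rewrite /shortest_path_between -/L => -[g0 gL /shortest_pathP gd].
have geo : geodesic 0 L (path_to p z).
  exists 1 => // s t s0 st tL _; apply/shortest_pathP => s' t' ? ? ?.
  by rewrite gd//; lra.
have [e e0 [h [e1 e10 hloc] hg]] := lgc _ _ _ L0 geo.
(* [eta] keeps [L - eta, L + eta] inside the domain of [h], at the scale where
   [h] is shortest, at nonnegative times and within distance [R0] of [p]. *)
pose eta := Num.min (Num.min e (e1 / 2)) (Num.min L (R0 - L)).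
have : eta <= eta by [].
rewrite {2}/eta !le_min => /andP[/andP[etae etae1] /andP[etaL etaR]].
have eta0 : 0 < eta by rewrite /eta !lt_min e0 L0 !andTb divr_gt0//= subr_gt0.
have hsp : shortest_path (L - eta) (L + eta) h by apply: hloc; lra.
have hE t : 0 <= t -> t <= L -> h t = path_to p z t.
  by move=> t0 tL; apply: hg; rewrite in_itv/= t0.
have ph t : 0 <= t -> t <= L -> mdist p (h t) = t.
  by move=> t0 tL; rewrite hE// (path_to_dist amb).
have hLz : h L = z by rewrite hE//; lra.
have zh t : 0 <= t -> t <= eta -> mdist z (h (L + t)) = t.
  by move=> t0 te; rewrite -{1}hLz; move/shortest_pathP : hsp => ->; lra.
have hB t : L - eta <= t -> t <= L + eta -> B (h t).
  move=> tl tr; apply: ball_B; have [tL|Lt] := lerP t L.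
    by rewrite ph//; lra.
  have := metric_triangle p z (h t); have := zh (t - L).
  by rewrite [L + _]addrC subrK -/L; lra.
have seg : segment_in C (2 * eta) (fun t => h (L - eta + t)).
  split; first lra.
    apply/shortest_pathP => s t s0 st te.
    by move/shortest_pathP : hsp => ->; lra.
  by move=> t /andP[t0 te]; apply: (ambient_sub amb); apply: hB; lra.
have := @midpoint_convex _ _ _ bnpc p _ _ eta eta (ambient_sub amb Bp) seg.
have -> : L - eta + eta = L by lra.
have -> : L - eta + (eta - eta) = L - eta by lra.
have -> : L - eta + (eta + eta) = L + eta by lra.
have pL := ph L (ltW L0) (lexx _).
have pLe : mdist p (h (L - eta)) = L - eta by apply: ph; lra.
rewrite pL pLe => mid.
have {}mid : L + eta <= mdist p (h (L + eta)) by have := mid; lra.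
have zhe := zh eta (ltW eta0) (lexx _).
exists (h (L + eta)); have := metric_triangle p z (h (L + eta)).
by rewrite -/L zhe => tri; split; lra.
Qed.

(** Among the points [z] of the ball such that [y] lies between [p] and [z], a
    farthest one exists by compactness, and [short_extension] places it on the
    sphere of radius [R0]. *)
Lemma shortest_path_extension p y (R0 : R) : locally_geodesically_complete X ->
  (forall q, mdist p q <= R0 -> B q) -> y <> p -> mdist p y <= R0 ->
  exists g, [/\ segment_in C R0 g, g 0 = p & g (mdist p y) = y].
Proof.
move=> lgc ball_B yp yR0.
have L0 : 0 < mdist p y by rewrite mdist_gt0; apply/eqP => /esym.
have Bp : B p by apply: ball_B; rewrite mdistxx; lra.
have By : B y by exact: ball_B.
pose K := C `&` ([set z | mdist p z <= R0] `&`
                 [set z | mdist p y <= mdist p z - mdist y z]).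
have cK : compact K.
  apply: compact_closedI; first exact: ambient_compact amb.
  apply: closedI.
    apply: (@closed_comp _ _ (mdist p : X -> R) [set t | t <= R0]).
      by move=> x _; exact: mdist_continuous.
    exact: closed_le.
  apply: (@closed_comp _ _ (fun z => mdist p z - mdist y z)
    [set t | mdist p y <= t]); last exact: closed_ge.
  by move=> x _; apply: cvgB; exact: mdist_continuous.
have Ky : K y.
  by split; [exact: ambient_sub amb _ By|split; rewrite //= mdistxx; lra].
have [z] := compact_EVT_max (ex_intro _ y Ky) cK
  (continuous_subspaceT (@mdist_continuous _ _ p)).
rewrite inE => -[Cz [/= zR0 pyz]] zmax.
have pzE : mdist p z = R0.
  apply/eqP; rewrite eq_le zR0/= leNgt; apply/negP => zlt.
  have zp : z <> p.
    by move=> E; move: pyz (mdist_ge0 y z); rewrite E mdistxx; lra.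
  have [w [zw wR0 pzw]] := short_extension lgc ball_B zp zlt.
  have Kw : K w.
    split; first by apply: (ambient_sub amb); exact: ball_B.
    by split => //=; have := metric_triangle y z w; lra.
  by have := zmax w; rewrite inE => /(_ Kw); lra.
have Bz : B z by exact: ball_B.
have yzE : mdist y z = R0 - mdist p y by have := metric_triangle p y z; lra.
have [g0 gL gsp] := path_toP amb Bp By; have [h0 hL hsp] := path_toP amb By Bz.
have := @concat_shortest_path _ _ _ _ (path_to p y) (path_to y z)
  (mdist_ge0 p y) (mdist_ge0 y z) gsp hsp.
rewrite gL h0 g0 hL => /(_ erefl).
have -> : mdist p y + mdist y z = R0 by lra.
move=> /(_ pzE); set f := (fun t : R => if _ then _ else _) => fsp.
exists f; rewrite /f; split; last 2 first.
- by rewrite /= mdist_ge0 g0.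
- by rewrite /= lexx gL.
rewrite -pzE; apply: (between_segment amb) => //; split => /=.
- by rewrite mdist_ge0.
- rewrite pzE; case: ifPn => [Ry|_]; last by rewrite -yzE.
  have ER : R0 = mdist p y by lra.
  by rewrite ER gL; apply: mdist_positivity; rewrite yzE ER subrr.
- by rewrite pzE.
Qed.

Section Uniform.
Variables (p : X) (R0 : R).
Hypothesis R00 : 0 < R0.
Hypothesis ball_B : forall q, mdist p q <= R0 -> B q.

Let Bp : B p. Proof. by apply: ball_B; rewrite mdistxx ltW. Qed.

Let BS u : mdist p u = R0 -> B u.
Proof. by move=> pu; apply: ball_B; rewrite pu. Qed.

(** This limits how far rays branch: two rays that share an initial piece are
    within [e * t] of each other at all times [t <= rho]. *)
Definition rays_spread (e rho : R) := forall u v s t,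
  mdist p u = R0 -> mdist p v = R0 -> 0 < s -> s <= t -> t <= rho ->
  mdist (path_to p u t) (path_to p v t) / t <=
    mdist (path_to p u s) (path_to p v s) / s + e.

Definition slope_spread z (e rho : R) := forall u s t,
  mdist p u = R0 -> 0 < s -> s <= t -> t <= rho ->
  slope z p u t <= slope z p u s + e.

Lemma ray_segment u : mdist p u = R0 ->
  segment_in C R0 (path_to p u) /\ path_to p u 0 = p.
Proof.
move=> pu; have Bu := BS pu.
have uP := path_toP amb Bp Bu.
by split; [rewrite -pu; exact: (between_segment amb Bp Bu uP)|case: uP].
Qed.

(** The equicontinuity behind both uniformity statements: at all times, ratios
    are controlled by the endpoints on the sphere. *)
Lemma ray_lipschitz u v t : mdist p u = R0 -> mdist p v = R0 -> 0 < t ->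
  t <= R0 -> mdist (path_to p u t) (path_to p v t) / t <= mdist u v / R0.
Proof.
move=> pu pv t0 tR0.
have [uS u0] := ray_segment pu; have [vS v0] := ray_segment pv.
have [_ uE _] := path_toP amb Bp (BS pu).
have [_ vE _] := path_toP amb Bp (BS pv).
have := cone_monotone bnpc uS vS (etrans u0 (esym v0)) (ltW t0) tR0 (lexx _).
rewrite pu in uE; rewrite pv in vE; rewrite uE vE => H.
by rewrite ler_pdivrMr// mulrAC ler_pdivlMr// mulrC (mulrC _ t).
Qed.

Let S := C `&` [set u | mdist p u = R0].

Let SE u : mdist p u = R0 -> S u.
Proof.
by move=> pu; split => //; exact: ambient_sub amb _ (BS pu).
Qed.

Lemma near_rays_spread e : 0 < e -> \forall rho \near 0^'+, rays_spread e rho.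
Proof.
move=> e0.
have cS : compact (S `*` S).
  by apply: compact_setX; apply: compact_metric_sphere (ambient_compact amb).
pose F t (a : X * X) := mdist (path_to p a.1 t) (path_to p a.2 t) / t.
have := @monotone_equicontinuous_uniform _ _ _ F _ 0 cS R00.
move=> /(_ _ _ _ e e0) H.
have : \forall rho \near 0^'+, forall a : X * X, (S `*` S) a ->
    forall s t, 0 < s -> s <= t -> t <= rho -> F t a <= F s a + e.
  apply: H.
  - move=> [u v] s t [/= [_ pu] [_ pv]] s0 st tR0.
    have [uS u0] := ray_segment pu; have [vS v0] := ray_segment pv.
    have t0 : 0 < t by lra.
    have := cone_monotone bnpc uS vS (etrans u0 (esym v0)) (ltW s0) st tR0.
    rewrite /F/= ler_pdivrMr// mulrAC ler_pdivlMr//.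
    by rewrite mulrC (mulrC _ s).
  - by move=> c t _ t0 _; rewrite /F divr_ge0// ?mdist_ge0// ltW.
  - move=> [u v] e' [/= [_ pu] [_ pv]] e'0.
    have d0 : 0 < e' / 2 * R0 by rewrite mulr_gt0// divr_gt0.
    exists ([set u' | mdist u u' < e' / 2 * R0],
            [set v' | mdist v v' < e' / 2 * R0]) => /=.
      by split; apply/metricType_numDomainType.nbhs_mdistP; exists (e' / 2 * R0).
    move=> [u' v'] /= [uu' vv'] [/= [_ pu'] [_ pv']] t t0 tR0.
    have Hu := ray_lipschitz pu pu' t0 tR0.
    have Hv := ray_lipschitz pv pv' t0 tR0.
    have {}uu' : mdist u u' / R0 <= e' / 2 by rewrite ler_pdivrMr// ltW.
    have {}vv' : mdist v v' / R0 <= e' / 2 by rewrite ler_pdivrMr// ltW.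
    rewrite /F/= -mulrBl normrM [`|t^-1|]gtr0_norm ?invr_gt0//.
    apply: le_trans (_ : (mdist (path_to p u t) (path_to p u' t) +
      mdist (path_to p v t) (path_to p v' t)) / t <= _); last first.
      by rewrite mulrDl; lra.
    rewrite ler_pM2r ?invr_gt0//.
    have := mdist_lipschitz (path_to p u' t) (path_to p v' t) (path_to p v t).
    have := mdist_lipschitz (path_to p v t) (path_to p u' t) (path_to p u t).
    rewrite (metric_sym (path_to p v' t)).
    rewrite (metric_sym (path_to p u' t) (path_to p u t)).
    rewrite !(metric_sym (path_to p v t) (path_to p u' t)).
    rewrite (metric_sym (path_to p v t) (path_to p u t)).
    by rewrite !ler_norml => /andP[? ?] /andP[? ?]; lra.
apply: filterS => rho Hrho u v s t pu pv s0 st trho.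
exact: (Hrho (u, v) (conj (SE pu) (SE pv)) s t s0 st trho).
Qed.

Lemma near_slope_spread z e : B z -> 0 < e ->
  \forall rho \near 0^'+, slope_spread z e rho.
Proof.
move=> Bz e0.
have cS : compact S := compact_metric_sphere (ambient_compact amb).
have := @monotone_equicontinuous_uniform _ _ _
  (fun t u => slope z p u t) _ (-1) cS R00.
move=> /(_ _ _ _ e e0) H.
have : \forall rho \near 0^'+, forall u, S u ->
    forall s t, 0 < s -> s <= t -> t <= rho ->
      slope z p u t <= slope z p u s + e.
  apply: H.
  - move=> u s t [_ /= pu] s0 st tR0.
    have [uS u0] := ray_segment pu.
    have := quotient_monotone bnpc (ambient_sub amb Bz) uS s0 st tR0.
    by rewrite u0.
  - move=> u t [_ /= pu] t0 tR0.
    have Bu := BS pu.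
    by rewrite -pu in tR0; case/andP: (slope_itv amb Bz Bp Bu t0 tR0).
  - move=> u e' [_ /= pu] e'0.
    have d0 : 0 < e' * R0 by rewrite mulr_gt0.
    apply/metricType_numDomainType.nbhs_mdistP.
    exists (e' * R0) => //= u' uu' [_ /= pu'] t t0 tR0.
    have Hu := ray_lipschitz pu pu' t0 tR0.
    have {}uu' : mdist u u' / R0 <= e' by rewrite ler_pdivrMr// ltW.
    apply: le_trans (le_trans Hu uu').
    have -> : slope z p u' t - slope z p u t =
      (mdist z (path_to p u' t) - mdist z (path_to p u t)) / t.
      by rewrite /slope; ring.
    rewrite normrM [`|t^-1|]gtr0_norm ?invr_gt0//.
    rewrite ler_pM2r ?invr_gt0// (metric_sym (path_to p u t)).
    exact: mdist_lipschitz.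
apply: filterS => rho Hrho u s t pu s0 st trho.
exact: (Hrho u (SE pu) s t s0 st trho).
Qed.

End Uniform.
End Ambient.
End Rays.

(** * Opposite directions *)

Section OppositeDirections.
Context {R : realType} {X : metricType R}.
Implicit Types (s t L : R) (g : R -> X) (B C : set X).
Implicit Types (x y z p q u v : X).

Section Ambient.
Variables (C B : set X).
Hypothesis amb : ambient C B.
Let bnpc := ambient_bnpc amb.

Variables (p : X) (R0 : R).
Hypothesis R00 : 0 < R0.
Hypothesis ball_B : forall q, mdist p q <= R0 -> B q.
Hypothesis lgc : locally_geodesically_complete X.

Lemma ray_through x : x <> p -> mdist p x <= R0 ->
  exists2 u, mdist p u = R0 & path_to p u (mdist p x) = x.
Proof.
move=> xp xR0.
have [g [gS g0 gx]] := shortest_path_extension amb lgc ball_B xp xR0.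
have [_ gP _] := gS.
have pg : mdist p (g R0) = R0.
  by rewrite -{1}g0 (shortest_path_between_length (ltW R00) gP).
exists (g R0) => //; rewrite -[RHS]gx.
apply: (path_to_unique amb).
- by apply: ball_B; rewrite mdistxx ltW.
- by apply: ball_B; rewrite pg.
- by split => //; rewrite pg.
- by rewrite pg mdist_ge0.
Qed.

(** For [y] near [x], extend the path from [p] to [y] by [g]. The ray to [q]
    and [g] are within [2 e r] of each other at time [r], where they pass
    through [x] and near [y], hence within [6 e r] at time [2 r] by uniformity.
    Then [fan_bound] at [y], with lengths at least [r / 2], gives the ratio
    [24 e]. *)
Lemma opposite_direction x (e rho : R) : 0 < e -> e <= 2^-1 -> x <> p ->
  2 * mdist p x <= rho -> rho <= R0 -> rays_spread p R0 e rho ->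
  exists q, [/\ mdist p q = 2 * mdist p x, mdist x q = mdist p x,
    (forall z, slope_spread p R0 z e rho -> mdist z p = mdist z x ->
       mdist z q <= mdist z p + 2 * mdist p x * e) &
    forall y, mdist x y <= e * mdist p x ->
      exists2 g : R -> X, segment_in C (2 * mdist p x) g &
        [/\ g 0 = p, g (mdist p y) = y &
          forall t, 0 <= t -> t <= 2 * mdist p x - mdist p y ->
            t <= mdist y q ->
            mdist (g (mdist p y + t)) (path_to y q t) <= 24 * e * t]].
Proof.
set r := mdist p x => e0 e12 xp rrho rhoR0 spread.
have r0 : 0 < r by rewrite mdist_gt0; apply/eqP => /esym.
have rR0 : r <= R0 by lra.
have Bp : B p by apply: ball_B; rewrite mdistxx ltW.
have [u pu ux] := ray_through xp rR0.
rewrite -/r in ux.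
have [[_ /shortest_pathP ud _] u0] := ray_segment amb R00 ball_B pu.
pose q := path_to p u (2 * r).
have pq : mdist p q = 2 * r by rewrite /q -{1}u0 ud; lra.
have xq : mdist x q = r by rewrite /q -{1}ux ud; lra.
have Bq : B q by apply: ball_B; rewrite pq; lra.
exists q; split => //.
  move=> z zs zx; have := zs u r (2 * r) pu r0.
  rewrite /slope ux -/q zx subrr mul0r add0r => H.
  have {}H : (mdist z q - mdist z x) / (2 * r) <= e by apply: H; lra.
  by rewrite ler_pdivrMr in H; lra.
move=> y xy.
have er : e * r <= r / 2 by rewrite mulrC ler_pM2l.
have yl : r - e * r <= mdist p y.
  by have := metric_triangle p y x; rewrite -/r (metric_sym y x); lra.
have yr : mdist p y <= r + e * r.
  by have := metric_triangle p x y; rewrite -/r; lra.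
have yp : y <> p by move=> E; move: yl; rewrite E mdistxx; lra.
have By : B y by apply: ball_B; lra.
have yR0 : mdist p y <= R0 by lra.
have [v pv vy] := ray_through yp yR0.
have [vS v0] := ray_segment amb R00 ball_B pv.
have [_ /shortest_pathP vd _] := vS.
exists (path_to p v).
  by apply: segment_in_prefix vS; lra.
split => // t t0 t1 t2.
pose q' := path_to p v (2 * r).
have qq' : mdist q' q <= 6 * e * r.
  have := spread v u r (2 * r) pv pu r0; rewrite ux -/q -/q' => H.
  have {}H : mdist q' q / (2 * r) <= mdist (path_to p v r) x / r + e.
    by apply: H; lra.
  have d1 : mdist (path_to p v r) x <= 2 * e * r.
    have := metric_triangle (path_to p v r) y x.
    have : mdist (path_to p v r) y <= e * r.
      rewrite -{1}vy; have [ry|/ltW ry] := lerP r (mdist p y).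
        by rewrite vd//; lra.
      by rewrite metric_sym vd//; lra.
    by rewrite (metric_sym y x); lra.
  have d2 : mdist (path_to p v r) x / r <= 2 * e by rewrite ler_pdivrMr.
  have {}H := le_trans H (lerD d2 (lexx _)).
  by rewrite ler_pdivrMr in H; lra.
have a0 : 0 < 2 * r - mdist p y by lra.
have vS' : segment_in C (2 * r - mdist p y)
    (fun t => path_to p v (mdist p y + t)).
  by apply: segment_in_sub vS; [exact: mdist_ge0|lra|lra].
have yqP := path_toP amb By Bq.
have yqS := between_segment amb By Bq yqP.
have [yq0 yqL _] := yqP.
have := fan_bound bnpc vS' yqS _ a0 t0 t1 t2.
rewrite addr0 vy yq0 yqL [mdist p y + (_ - _)]addrC subrK -/q'.
move=> /(_ erefl) /le_trans; apply.
rewrite ler_pdivrMr//.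
have -> : 24 * e * t * (2 * r - mdist p y) =
  2 * t * (12 * e * (2 * r - mdist p y)) by ring.
apply: ler_wpM2l; first lra.
apply: le_trans qq' _.
have -> : 6 * e * r = 12 * e * (r / 2) by field.
by apply: ler_wpM2l; lra.
Qed.

(** The path from [y] back to [p] runs along [g]; the path from [y] to [q] stays
    within [k t] of [g] after [y]. Convexity along [g] would make the sum of the
    slopes nonnegative, and the deviation costs at most [k]. *)
Lemma slope_add_ge z y q g (L k : R) : B z -> B y -> B q -> y <> p -> q <> y ->
  B p -> segment_in C L g -> g 0 = p -> g (mdist p y) = y -> mdist p y < L ->
  (forall t, 0 <= t -> t <= L - mdist p y -> t <= mdist y q ->
    mdist (g (mdist p y + t)) (path_to y q t) <= k * t) ->
  \forall t \near 0^'+, - k <= slope z y p t + slope z y q t.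
Proof.
move=> Bz By Bq yp qy Bp gS g0 gy yL gk.
have py0 : 0 < mdist p y by rewrite mdist_gt0; apply/eqP => /esym.
have yq0 : 0 < mdist y q by rewrite mdist_gt0; apply/eqP => /esym.
have Ly0 : 0 < L - mdist p y by lra.
near=> t.
have t0 : 0 < t by near: t; exact: nbhs_right_gt.
have tpy : t <= mdist p y by near: t; exact: nbhs_right_le.
have tyq : t <= mdist y q by near: t; exact: nbhs_right_le.
have tL : t <= L - mdist p y by near: t; exact: nbhs_right_le.
have pyt : path_to y p t = g (mdist p y - t).
  apply: (path_to_unique amb By Bp (g := fun t => g (mdist p y - t)));
    last by rewrite (metric_sym y p) ltW.
  have [_ rS _] := segment_in_rev (mdist_ge0 p y) (ltW yL) gS.
  by split; rewrite ?subr0// metric_sym// subrr.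
have := midpoint_convex bnpc (ambient_sub amb Bz) gS
  (mdist_ge0 p y) (ltW t0) _ _ (t := t).
rewrite subr_ge0 tpy -lerBrDl tL gy => /(_ isT isT) mid.
have := gk t (ltW t0) tL tyq.
have := mdist_lipschitz z (g (mdist p y + t)) (path_to y q t).
rewrite ler_norml => /andP[_ h1] h2.
rewrite /slope pyt -mulrDl ler_pdivlMr//.
by lra.
Unshelve. all: by end_near. Qed.

Lemma slope_opposite_ge y q g (L k : R) : B y -> B q -> q <> y ->
  B p -> segment_in C L g -> g 0 = p -> g (mdist p y) = y -> mdist p y < L ->
  (forall t, 0 <= t -> t <= L - mdist p y -> t <= mdist y q ->
    mdist (g (mdist p y + t)) (path_to y q t) <= k * t) ->
  \forall t \near 0^'+, 1 - k <= slope p y q t.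
Proof.
move=> By Bq qy Bp [_ /shortest_pathP gd _] g0 gy yL gk.
have yq0 : 0 < mdist y q by rewrite mdist_gt0; apply/eqP => /esym.
have Ly0 : 0 < L - mdist p y by lra.
near=> t.
have t0 : 0 < t by near: t; exact: nbhs_right_gt.
have tyq : t <= mdist y q by near: t; exact: nbhs_right_le.
have tL : t <= L - mdist p y by near: t; exact: nbhs_right_le.
have := gk t (ltW t0) tL tyq.
have := mdist_lipschitz p (g (mdist p y + t)) (path_to y q t).
have -> : mdist p (g (mdist p y + t)) = mdist p y + t.
  have := mdist_ge0 p y => py0.
  by rewrite -{1}g0 gd//; lra.
rewrite ler_norml => /andP[_ h1] h2.
rewrite /slope ler_pdivlMr//.
by lra.
Unshelve. all: by end_near. Qed.

(** The derivative of [mdist z] at [y] lies between [- 30 e] and [2 e] towards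
    [p], and between [- 26 e] and [6 e] towards [q]: the upper bounds come from
    the slopes over the whole paths, the lower ones from [slope_add_ge] with
    [k = 24 e]. *)
Lemma opposite_strainer_near x (delta e rho : R) : acos_sharp delta (30 * e) ->
  0 < e -> e <= 2^-1 -> x <> p ->
  2 * mdist p x <= rho -> rho <= R0 -> rays_spread p R0 e rho ->
  exists2 q, B q & mdist x q = mdist p x /\
    forall y, mdist x y <= e * mdist p x ->
      pi - delta < angle p y q /\
      forall z, B z -> z <> y -> slope_spread p R0 z e rho ->
        mdist z p = mdist z x ->
        almost_right delta (angle z y p) /\ almost_right delta (angle z y q).
Proof.
set r := mdist p x => acosP e0 e12 xp rrho rhoR0 spread.
have r0 : 0 < r by rewrite mdist_gt0; apply/eqP => /esym.
have Bp : B p by apply: ball_B; rewrite mdistxx ltW.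
have [q [pq xq zq ray]] := opposite_direction e0 e12 xp rrho rhoR0 spread.
rewrite -/r in pq xq zq ray.
have Bq : B q by apply: ball_B; rewrite pq; lra.
exists q => //; split => // y xy.
have er : e * r <= r / 2 by rewrite mulrC ler_pM2l.
have yl : r - e * r <= mdist p y.
  by have := metric_triangle p y x; rewrite -/r (metric_sym y x); lra.
have yr : mdist p y <= r + e * r.
  by have := metric_triangle p x y; rewrite -/r; lra.
have yql : r - e * r <= mdist y q.
  by have := metric_triangle x y q; lra.
have yp : y <> p by move=> E; move: yl; rewrite E mdistxx; lra.
have qy : q <> y by move=> E; move: yql; rewrite E mdistxx; lra.
have py : p <> y by move=> E; apply: yp.
have By : B y by apply: ball_B; lra.
have [g gS [g0 gy gk]] := ray y xy.
have yL : mdist p y < 2 * r by lra.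
split.
  have [D cD _] := slope_cvg amb Bp By Bq qy.
  have [DI ->] := angle_acos amb Bp By Bq py qy cD.
  have D1 : 1 - 24 * e <= D.
    exact: cvgr_to_ge cD (slope_opposite_ge By Bq qy Bp gS g0 gy yL gk).
  have DI' : -1 <= - D <= 1 by lra.
  by apply: (acosP _ DI').1; lra.
move=> z Bz zy zs zpx.
have [D1 cD1 D1le] := slope_cvg amb Bz By Bp py.
have [D2 cD2 D2le] := slope_cvg amb Bz By Bq qy.
have [D1I ->] := angle_acos amb Bz By Bp zy py cD1.
have [D2I ->] := angle_acos amb Bz By Bq zy qy cD2.
have zy_xy : mdist z p <= mdist z y + e * r.
  by have := metric_triangle z y x; rewrite zpx (metric_sym y x); lra.
have D1e : D1 <= 2 * e.
  apply: le_trans D1le _; rewrite (metric_sym y p) ler_pdivrMr; last lra.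
  have : e * (r / 2) <= e * mdist p y by rewrite ler_pM2l//; lra.
  by lra.
have D2e : D2 <= 6 * e.
  apply: le_trans D2le _; rewrite ler_pdivrMr; last lra.
  have := zq z zs zpx.
  have : e * (r / 2) <= e * mdist y q by rewrite ler_pM2l//; lra.
  by lra.
have D12 : - (24 * e) <= D1 + D2.
  apply: cvgr_to_ge (cvgD cD1 cD2) _.
  exact: slope_add_ge gS g0 gy yL gk.
have D1I' : -1 <= - D1 <= 1 by lra.
have D2I' : -1 <= - D2 <= 1 by lra.
by split; [apply: (acosP _ D1I').2|apply: (acosP _ D2I').2];
  rewrite ler_norml; lra.
Qed.

End Ambient.

End OppositeDirections.

(** * Strainers under small displacements *)

Section Bookkeeping.
Context {R : realType} {X : metricType R}.
Implicit Types (B C U : set X) (p pb pbar : nat -> X) (x y z : X) (delta : R).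

Lemma strainer_ext B delta k p pb p' pb' x :
  (forall i, (1 <= i <= k)%N -> p i = p' i /\ pb i = pb' i) ->
  strainer B delta k p pb x -> strainer B delta k p' pb' x.
Proof.
elim: k => [//|[_|k IH]] E.
  by rewrite /=; have [-> ->] := E 1%N isT.
move=> /= [H1 H2 [U [nU UB Up Upb UA]]].
have [Ep Epb] := E k.+2 (leqnn _).
split.
- apply: IH H1 => i /andP[i1 ik]; apply: E; rewrite i1/=; exact: leqW.
- by rewrite -Ep -Epb.
- exists U; split => //.
  + by move=> i iI; rewrite -(E i iI).1; exact: Up.
  + by rewrite -Epb.
  + move=> y i Uy iI; rewrite -Ep -Epb -(E i _).1; first exact: UA.
    by case/andP: iI => -> /leqW.
Qed.

Lemma strainer_near B delta k p pb x : strainer B delta k p pb x ->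
  \forall y \near x, strainer B delta k p pb y.
Proof.
have opp z zb : opposite_strainer B delta z zb x ->
    \forall y \near x, opposite_strainer B delta z zb y.
  move=> [Bz Bzb [U [nU UB Uz Uzb UA]]].
  have := nbhs_interior nU; apply: filterS => y Uy.
  by split => //; exists U.
elim: k => [|[_|k IH]]; first by move=> _; exact: nearW.
  exact: opp.
move=> /= [H1 H2 [U [nU UB Up Upb UA]]].
have := nbhs_interior nU; apply: filterS3 (IH H1) (opp _ _ H2) => y h1 h2 Uy.
by split => //; exists U.
Qed.

Lemma strainer_away B delta k p pb x : strainer B delta k p pb x ->
  forall i, (1 <= i <= k)%N -> B (p i) /\ p i <> x.
Proof.
elim: k => [_ [|[]]//|[_|k IH]].
  move=> [Bp _ [U [nU _ Up _ _]]] [//|[|//]] _; split => //.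
  by move=> E; apply: Up; rewrite E; exact: nbhs_singleton.
move=> /= [H1 [Bp _ [U [nU _ Up _ _]]] _] i /andP[i1].
rewrite leq_eqVlt => /orP[/eqP ->|ik]; last by apply: IH H1 _ _; rewrite i1.
split => //.
by move=> E; apply: Up; rewrite E; exact: nbhs_singleton.
Qed.

Lemma strainer_succ B delta k p pbar x : strainer B delta k p pbar x ->
  opposite_strainer B delta (p k.+1) (pbar k.+1) x ->
  (exists U : set X,
    [/\ nbhs x U, U `<=` B, forall i, (1 <= i <= k.+1)%N -> ~ U (p i),
        ~ U (pbar k.+1) &
        forall y i, U y -> (1 <= i <= k)%N ->
          almost_right delta (angle (p i) y (p k.+1)) /\
          almost_right delta (angle (p i) y (pbar k.+1))]) ->
  strainer B delta k.+1 p pbar x.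
Proof. by case: k => [|k] st opp H //; split. Qed.

(** A form of the hypothesis in which the base case [k = 0] needs no separate
    treatment: there the points of [B] nearer to [x] than [p 0] form [U]. *)
Lemma extended_strainer_data C B delta k p x : ambient C B ->
  extended_strainer B delta k p x ->
  exists pbar U,
    [/\ strainer B delta k p pbar x,
        nbhs x U, U `<=` B,
        forall i, (i <= k)%N -> B (p i) /\ ~ U (p i) &
        forall i, (1 <= i <= k)%N -> ~ U (pbar i) /\ forall y, U y ->
          almost_right delta (angle (p 0%N) y (p i)) /\
          almost_right delta (angle (p 0%N) y (pbar i))].
Proof.
move=> amb; rewrite /extended_strainer; case: eqVneq => [->|k0].
  move=> [Bp Bx xp]; exists p, [set y | B y /\ mdist x y < mdist x (p 0%N)].
  have xp0 : 0 < mdist x (p 0%N) by rewrite mdist_gt0; apply/eqP.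
  have [e e0 eB] := ambient_open amb Bx.
  split => //.
  - apply/metricType_numDomainType.nbhs_mdistP.
    exists (Num.min e (mdist x (p 0%N))); rewrite /= ?lt_min ?e0//.
    by move=> y /=; rewrite lt_min => /andP[/eB].
  - by move=> y [].
  - by move=> [|//] _; split=> // -[_]; rewrite ltxx.
  - by move=> [].
move=> [Bp [pbar st [U [nU UB Up0 Up UA]]]]; exists pbar, U; split => //.
  move=> [_|i ik]; first by [].
  split; last exact: (Up i.+1 ik).1.
  exact: (strainer_away st (i := i.+1) ik).1.
move=> i ik; split; first exact: (Up i ik).2.
by move=> y Uy; exact: UA.
Qed.

End Bookkeeping.

Theorem proposition6p4 (R : realType) :
  exists2 c : R, 0 < c &
    forall delta : R, 0 < delta -> delta < c ->
    forall (X : metricType R) (B : set X) (k : nat) (p : nat -> X),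
      GNPC X -> tiny_ball B -> (1 <= k)%N -> B (p k) ->
      extended_strainer B delta k.-1 p (p k) ->
      exists2 rho : R, 0 < rho &
        forall x : X, B x -> x <> p k -> mdist x (p k) < rho ->
          (forall i : nat, (i <= k.-1)%N -> mdist (p i) (p k) = mdist (p i) x) ->
          extended_strainer B delta k p x.
Proof.
exists 1 => // delta d0 _ X B [//|n] p [_ _ lgc _] tB _ Bpk /=.
have [C amb] := tiny_ball_ambient tB.
move=> /(extended_strainer_data amb)[pbar [U [st nU UB Up UA]]].
have [e0 e00 acosP] := acos_sharp_exists d0.
pose e := Num.min (e0 / 30) 2^-1.
have e_gt0 : 0 < e by rewrite lt_min !divr_gt0//= invr_gt0.
have [e_e0 e12] : e <= e0 / 30 /\ e <= 2^-1.
  by split; rewrite ge_min lexx ?orbT.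
have {acosP}sharp : acos_sharp delta (30 * e).
  move=> c /acosP[h1 h2]; split => hc; [apply: h1|apply: h2]; lra.
have [s s0 sB] := ambient_open amb Bpk.
have R00 : 0 < s / 2 by rewrite divr_gt0.
have ball_B q : mdist (p n.+1) q <= s / 2 -> B q.
  by move=> h; apply: sB; lra.
have [rho0 [rho00 rho0R spread slopes]] : exists rho : R, [/\ 0 < rho,
    rho <= s / 2, rays_spread (p n.+1) (s / 2) e rho &
    forall i : 'I_n.+1, slope_spread (p n.+1) (s / 2) (p i) e rho].
  near (0 : R)^'+ => rho; exists rho; split; near: rho.
  - exact: nbhs_right_gt.
  - exact: nbhs_right_le.
  - exact: (near_rays_spread amb R00 ball_B e_gt0).
  - apply: filter_forall => i; apply: (near_slope_spread amb R00 ball_B) => //.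
    by case: (Up i (ltn_ord i)).
have [/= eta eta0 near_pk] :=
  (metricType_numDomainType.nbhs_mdistP _ _).1
    (filterI (strainer_near st) (nbhs_interior nU)).
exists (Num.min (rho0 / 2) eta); first by rewrite lt_min eta0 divr_gt0.
move=> x Bx xpk; rewrite metric_sym lt_min => /andP[xrho xeta] pix.
have [stx nUx] := near_pk x xeta.
have xrho0 : 2 * mdist (p n.+1) x <= rho0 by lra.
have [q Bq [xq near_x]] := opposite_strainer_near amb R00 ball_B lgc sharp
  e_gt0 e12 xpk xrho0 rho0R spread.
set r := mdist (p n.+1) x in xq near_x.
have r0 : 0 < r by rewrite mdist_gt0; apply/eqP => /esym.
have err : e * r < r by rewrite gtr_pMl//; lra.
(* A single neighborhood serves in all conditions of the definition. *)
pose V := U `&` [set y | mdist x y <= e * r].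
have nV : nbhs x V.
  apply: filterI => //; apply/metricType_numDomainType.nbhs_mdistP.
  by exists (e * r) => [|y /= /ltW//]; rewrite /= mulr_gt0.
have VB : V `<=` B by move=> y [/UB].
have Vp i : (i <= n.+1)%N -> ~ V (p i).
  rewrite leq_eqVlt => /orP[/eqP ->|ik [Upi _]]; last exact: (Up i ik).2.
  by move=> [_ /=]; rewrite metric_sym -/r; lra.
have Vq : ~ V q by move=> [_ /=]; rewrite xq; lra.
have VA y i : V y -> (i <= n)%N ->
    almost_right delta (angle (p i) y (p n.+1)) /\
    almost_right delta (angle (p i) y q).
  move=> [Uy xy] ik; apply: (near_x y xy).2 => //.
  - exact: (Up i ik).1.
  - by move=> E; apply: (Up i ik).2; rewrite E.
  - exact: (slopes (Ordinal (ik : (i < n.+1)%N))).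
  - exact: pix.
pose qbar i := if i == n.+1 then q else pbar i.
have qbarE : qbar n.+1 = q by rewrite /qbar eqxx.
have qbar_old i : (i <= n)%N -> qbar i = pbar i.
  by move=> ik; rewrite /qbar ltn_eqF.
have opp : opposite_strainer B delta (p n.+1) (qbar n.+1) x.
  split; rewrite ?qbarE//; exists V; split => //; first exact: Vp.
  by move=> y [_ xy]; exact: (near_x y xy).1.
split; first exact: (Up 0%N isT).1.
exists qbar.
  have stn : strainer B delta n p qbar x.
    by apply: strainer_ext stx => i /andP[_ ik]; rewrite qbar_old.
  apply: strainer_succ stn opp _; exists V; split => //.
  - by move=> i /andP[_]; exact: Vp.
  - by rewrite qbarE.
  - by move=> y i Vy /andP[_ ik]; rewrite qbarE; exact: VA.
exists V; split => //; first exact: Vp.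
  move=> i /andP[i1 ik]; split; first exact: Vp.
  move: ik; rewrite leq_eqVlt => /orP[/eqP ->|ik]; first by rewrite qbarE.
  by rewrite qbar_old// => -[]; have [] := UA i; rewrite ?i1.
move=> y i Vy /andP[i1].
rewrite leq_eqVlt => /orP[/eqP ->|ik]; first by rewrite qbarE; exact: VA.
by rewrite qbar_old//; have [|_] := UA i; [rewrite i1|apply; case: Vy].
Unshelve. all: by end_near. Qed.
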